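(* Let $V$ be a quadratic stochastic operator on $S$ with heredity coefficients $\{P_{ij,k}\}_{i,j,k\in\mathbb{N}}$, and for $i,j\in\mathbb{N}$ let $\mathbb{P}_{ij}=(P_{ij,1},P_{ij,2},\dots,P_{ij,n},\dots)\in S$. Then the following conditions are equivalent: (i) $V$ is orthogonal preserving; (ii) for any $A,B\subset\mathbb{N}$ with $A\cap B=\emptyset$ one has $\mathbb{P}_{ij}\perp\mathbb{P}_{uv}$ for all $i,j\in A$ and all $u,v\in B$.
   Context: $S=\{\mathbf{x}=(x_i)_{i\in\mathbb{N}}\in\mathbb{R}^{\mathbb{N}} : x_i\ge 0,\ \sum_{i}x_i=1\}$. For $\mathbf{x}\in S$, $supp(\mathbf{x})=\{i\in\mathbb{N}: x_i\neq 0\}$; $\mathbf{x},\mathbf{y}\in S$ are orthogonal, $\mathbf{x}\perp\mathbf{y}$, if $supp(\mathbf{x})\cap supp(\mathbf{y})=\emptyset$. A quadratic stochastic operator (QSO) is a map $V:S\to S$ of the form $V(\mathbf{x})_k=\sum_{i,j\in\mathbb{N}}P_{ij,k}x_ix_j$, $k\in\mathbb{N}$, where the heredity coefficients satisfy $P_{ij,k}\ge 0$, $P_{ij,k}=P_{ji,k}$ and $\sum_{k\in\mathbb{N}}P_{ij,k}=1$ for all $i,j,k\in\mathbb{N}$. A QSO $V$ is orthogonal preserving (OP) if $\mathbf{x}\perp\mathbf{y}$ implies $V(\mathbf{x})\perp V(\mathbf{y})$ for all $\mathbf{x},\mathbf{y}\in S$. *)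

(* Defs.v *)
From HB Require Import structures.
From mathcomp Require Import all_boot all_order all_algebra.
From mathcomp Require Import all_classical all_reals all_analysis.

Set Implicit Arguments.
Unset Strict Implicit.
Unset Printing Implicit Defensive.

Import Order.TTheory GRing.Theory Num.Theory.
Local Open Scope classical_set_scope.
Local Open Scope ring_scope.

(* Coordinates are indexed from 0, i.e. the index set N is the type nat. *)
Record simplex (R : realType) := Simplex {
  coord :> nat -> R ;
  coord_ge0 : forall i, 0 <= coord i ;
  coord_sum1 : (\sum_(0 <= i <oo) (coord i)%:E = 1)%E
}.

Definition supp (R : realType) (x : simplex R) : set nat :=
  [set i | x i <> 0].

Definition orth_simplex (R : realType) (x y : simplex R) : Prop :=
  supp x `&` supp y = set0.

Record heredity (R : realType) := Heredity {
  hcoef :> nat -> nat -> nat -> R ;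
  hcoef_ge0 : forall i j k, 0 <= hcoef i j k ;
  hcoef_sym : forall i j k, hcoef i j k = hcoef j i k ;
  hcoef_sum1 : forall i j, (\sum_(0 <= k <oo) (hcoef i j k)%:E = 1)%E
}.

Definition hdist (R : realType) (P : heredity R) (i j : nat) : simplex R :=
  @Simplex R (P i j) (@hcoef_ge0 R P i j) (@hcoef_sum1 R P i j).

(* All terms are nonnegative, so the double series is the unordered sum over
   nat * nat; the equation in \bar R also says that this sum is finite. *)
Definition is_qso (R : realType) (P : heredity R)
    (V : simplex R -> simplex R) : Prop :=
  forall (x : simplex R) (k : nat),
    ((V x k)%:E =
     \esum_(p in [set: nat * nat]) (P p.1 p.2 k * x p.1 * x p.2)%:E)%E.

Definition orthogonal_preserving (R : realType)
    (V : simplex R -> simplex R) : Prop :=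
  forall x y : simplex R, orth_simplex x y -> orth_simplex (V x) (V y).

(* Main.v *)
Require Import Defs.
From HB Require Import structures.
From mathcomp Require Import all_boot all_order all_algebra.
From mathcomp Require Import all_classical all_reals all_analysis.

Set Implicit Arguments.
Unset Strict Implicit.
Unset Printing Implicit Defensive.

Local Open Scope classical_set_scope.
Local Open Scope ring_scope.

(** Since all terms of the defining series are nonnegative, [supp (V x)] is the
    union of the supports of the distributions [hdist P i j] over [i], [j] in
    [supp x].  Hence (ii) with [A = supp x], [B = supp y] gives (i); conversely,
    (i) is applied to the midpoints of the vertices [i], [j] and [u], [v]. *)

Import Order.TTheory GRing.Theory Num.Theory.

Lemma supp_qso (R : realType) (P : heredity R) (V : simplex R -> simplex R)
    (x : simplex R) (k : nat) :
  is_qso P V ->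
  supp (V x) k <-> exists i j, [/\ supp x i, supp x j & supp (hdist P i j) k].
Proof.
move=> hV; have term_ge0 p : (0 <= (P p.1 p.2 k * x p.1 * x p.2)%:E)%E.
  by rewrite lee_fin !mulr_ge0 ?hcoef_ge0 ?coord_ge0.
split=> [Vk | [i [j [xi xj Pk]]] Vk].
  (* A nonzero term would supply such a pair [i], [j]; without one the whole series vanishes. *)
  apply: contrapT => none; apply: Vk; apply: EFin_inj; rewrite hV.
  apply: esum1 => -[i j] _ /=; congr EFin; apply: contrapT => /eqP.
  rewrite !mulf_eq0 !negb_or => /andP[/andP[/eqP Pk /eqP xi] /eqP xj].
  by apply: none; exists i, j.
(* A nonnegative series dominates each of its terms, so if it sums to 0, some factor of the term at
   [(i, j)] is 0. *)
have /eqP : (P i j k * x i * x j)%:E = 0%E.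
  apply/eqP; rewrite eq_le (term_ge0 (i, j)) andbT.
  have <- : (V x k)%:E = 0%E by rewrite Vk.
  rewrite hV; apply: esum_ge; exists [set (i, j)]; last by rewrite fsbig_set1.
  by split=> //; exact: finite_set1.
rewrite eqe !mulf_eq0 => /orP[/orP[] |] /eqP; [exact: Pk | exact: xi | exact: xj].
Qed.

Lemma nneseries_vertex (R : realType) (i : nat) :
  (\sum_(0 <= n <oo) ((n == i)%:R : R)%:E = 1)%E.
Proof.
rewrite (@nneseriesD1 _ _ i) //= ?eqxx.
by rewrite eseries0 ?adde0 // => n _ /negPf ->.
Qed.

Section Midpoint.
Variables (R : realType) (i j : nat).

(** As a sum of two halves, the formula also covers [i = j], where it gives the vertex [i]. *)
Definition midpoint_coord (n : nat) : R :=
  2^-1 * (n == i)%:R + 2^-1 * (n == j)%:R.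

Lemma midpoint_coord_ge0 n : 0 <= midpoint_coord n.
Proof. by rewrite addr_ge0 // mulr_ge0 // invr_ge0. Qed.

Lemma midpoint_coord_sum1 : (\sum_(0 <= n <oo) (midpoint_coord n)%:E = 1)%E.
Proof.
under eq_eseriesr do rewrite EFinD !EFinM.
have ge0 m n : (0 <= ((n == m :> nat)%:R : R)%:E)%E by rewrite lee_fin.
rewrite nneseriesD; first last.
- by move=> n _ _; rewrite mule_ge0 // lee_fin invr_ge0.
- by move=> n _ _; rewrite mule_ge0 // lee_fin invr_ge0.
rewrite !nneseriesZl // !nneseries_vertex !mule1 -EFinD.
by congr EFin; rewrite [RHS]splitr div1r.
Qed.

Definition midpoint : simplex R :=
  Simplex midpoint_coord_ge0 midpoint_coord_sum1.

Lemma supp_midpoint : supp midpoint = [set i; j].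
Proof.
have half_gt0 : 0 < 2^-1 :> R by rewrite invr_gt0.
apply/seteqP; split=> n; rewrite /supp /= /midpoint_coord.
  by case: (eqVneq n i) => [|_]; [left | case: (eqVneq n j) => [|_];
    [right | rewrite !mulr0 addr0]].
move=> nij; apply/eqP; rewrite gt_eqF //.
(* One summand is 1/2; the other is only known to be nonnegative, as [i = j] is allowed. *)
case: nij => ->; rewrite eqxx mulr1.
  by rewrite ltr_pwDl // mulr_ge0 // ltW.
by rewrite ltr_wpDl // mulr_ge0 // ltW.
Qed.

End Midpoint.

Theorem theorem3p1 (R : realType) (P : heredity R)
    (V : simplex R -> simplex R) (hV : is_qso P V) :
  orthogonal_preserving V <->
  (forall A B : set nat, A `&` B = set0 ->
     forall i j u v : nat, A i -> A j -> B u -> B v ->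
       orth_simplex (hdist P i j) (hdist P u v)).
Proof.
split=> [VOP A B AB0 i j u v Ai Aj Bu Bv | POP x y xy0].
  (* Vertices alone would detect only [P i i] and [P u u]; the mixed coefficients enter once both
     indices lie in the support. *)
  have mid_orth : orth_simplex (midpoint R i j) (midpoint R u v).
    rewrite /orth_simplex !supp_midpoint; apply/seteqP; split=> // n [nij nuv].
    by rewrite -AB0; split; [case: nij | case: nuv] => ->.
  apply/seteqP; split=> // k [Pij Puv]; rewrite -(VOP _ _ mid_orth); split.
  - apply/(supp_qso _ _ hV); exists i, j.
    by rewrite !supp_midpoint; split=> //; [left | right].
  - apply/(supp_qso _ _ hV); exists u, v.
    by rewrite !supp_midpoint; split=> //; [left | right].
apply/seteqP; split=> // k [].
move=> /(supp_qso _ _ hV)[i [j [xi xj Pij]]].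
move=> /(supp_qso _ _ hV)[u [v [yu yv Puv]]].
(* [xy0] fixes the two sets as [supp x] and [supp y]; the goal [set0 k] is rewritten backwards into
   the intersection of the two supports, which contains [k]. *)
by rewrite -(POP _ _ xy0 i j u v).
Qed.
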